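(* For every $c>0$, $R>0$ and $\omega>0$ there exists $\Lambda_\star>0$, depending only on $c$, $\omega$ and $R$, such that the following holds for every $\kappa>0$ and $\Theta\in\mathbb{R}$. If $\Lambda\in(0,\Lambda_\star)$ and the kernel $K$ satisfies $$K(r)\le\Lambda\,\chi_{(-R,R)}(r)\qquad\text{for all }r\in\mathbb{R},$$ then there exists a solution of $$\partial_t u(x,t)=c\,\partial_x^2u(x,t)+\int_{\mathbb{R}}\big(u(y,t)-\Theta\big)_+\,K(x-y)\,dy,\qquad x\in\mathbb{R},\ t\in\mathbb{R},$$ of the form $$u(x,t)=v(x+\omega t)+\Theta$$ for some $v:\mathbb{R}\to\mathbb{R}$ satisfying $v(0)=0$ and $v'(0)=\kappa$.
   Context: Here $r_+:=\max\{r,0\}$, $\chi_A$ is the characteristic function of the set $A$, and $K:\mathbb{R}\to[0,+\infty)$ is a nonnegative measurable function. Solutions are classical: $u$ is continuously differentiable in $t$ and twice continuously differentiable in $x$, so that $v\in C^2(\mathbb{R})$, the integral is finite, and the equation holds pointwise. *)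

(* Defs.v *)
From HB Require Import structures.
From mathcomp Require Import all_boot all_order all_algebra.
From mathcomp Require Import all_classical all_reals all_analysis.

Set Implicit Arguments.
Unset Strict Implicit.
Unset Printing Implicit Defensive.

Import Order.TTheory GRing.Theory Num.Theory.
Import numFieldNormedType.Exports.

Local Open Scope ring_scope.
Local Open Scope classical_set_scope.

(* Measurability for the sigma-algebra on which completed_lebesgue_measure is
   defined, that is, of Lebesgue-measurable rather than only Borel sets. *)
Definition lebesgue_measurable (R : realType) (f : R -> R) : Prop :=
  @measurable_fun _ _ (caratheodory_type ((@wlength R idfun)^*)%mu) R setT f.

(* Functions of (x, t) are curried: u x t. *)
Definition dt (R : realType) (u : R -> R -> R) (x t : R) : R :=
  derive1 (fun s => u x s) t.
Definition dx (R : realType) (u : R -> R -> R) (x t : R) : R :=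
  derive1 (fun y => u y t) x.

(* Classical C^{2,1} regularity: u_t, u_x and u_xx exist everywhere (derive1 is
   total), and u and these derivatives are jointly continuous in (x, t). *)
Definition classical_regularity (R : realType) (u : R -> R -> R) : Prop :=
  [/\ (forall x t, derivable (fun s => u x s) t 1),
      (forall x t, derivable (fun y => u y t) x 1),
      (forall x t, derivable (fun y => dx u y t) x 1) &
      [/\ continuous (fun z : R * R => u z.1 z.2),
          continuous (fun z : R * R => dt u z.1 z.2),
          continuous (fun z : R * R => dx u z.1 z.2) &
          continuous (fun z : R * R => dx (dx u) z.1 z.2)]].

(* Rintegral is total, so finiteness of the integral is a separate clause. *)
Definition classical_solution (R : realType) (c Theta : R) (K : R -> R)
    (u : R -> R -> R) : Prop :=
  classical_regularity u /\
  forall x t,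
    (@completed_lebesgue_measure R).-integrable setT
      (fun y => (Num.max (u y t - Theta) 0 * K (x - y))%:E) /\
    dt u x t = c * dx (dx u) x t +
      Rintegral (@completed_lebesgue_measure R) setT
        (fun y => Num.max (u y t - Theta) 0 * K (x - y)).

(* Main.v *)
Require Import Defs.
From mathcomp Require Import all_boot all_order all_algebra.
From mathcomp Require Import all_classical all_reals all_analysis.
From mathcomp Require Import measurable_realfun.
From mathcomp Require Import ring lra.

Import Order.TTheory GRing.Theory Num.Theory.
Import numFieldNormedType.Exports.

Local Open Scope ring_scope.
Local Open Scope classical_set_scope.

(** Write [a := omega / c].  A profile [v] travels with speed [omega] exactly
when [v'' = a v' - F v / c], where [F v x] is the integral of [v_+ (x - r) K r]
over [r].  Without the nonlocal term the solution with [v 0 = 0] and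
[v' 0 = kappa] is [kappa / a * (exp (a x) - 1)]; a weak kernel only perturbs it.

The perturbation is controlled in the sup norm weighted by [exp (2 a |x|)].  Any
exponential rate above [a] would do: the weight must outgrow [exp (a x)] at [+oo]
so that integrating the linear equation from [0] costs only a constant factor,
and symmetric growth at [-oo] is harmless.  Since [K] lives in [(-rho, rho)], the
map [F] is Lipschitz for this norm, with constant
[Lambda * 2 rho * exp (2 a rho)]: shifting the argument by at most [rho]
multiplies the weight by at most [exp (2 a rho)] ([delayed_source_lipschitz]).
Solving [w' = a w - F v / c], [w 0 = kappa] and then [V' = w], [V 0 = 0] divides
the Lipschitz constant by [c * a * (2 a)] ([linear_ode], [antiderivative],
[growth_line]).  Thus [v |-> V] contracts by one half as soon as
[Lambda * 2 rho * exp (2 a rho) <= c a^2], a bound in which neither [kappa] nor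
[Theta] occurs, and its fixed point ([weighted_fixed_point]) is the profile.

Regularity is then automatic: [F v] is continuous because, after the change of
variables [y = x - r], only the continuous function [v_+] depends on [x].  The
equation is stated with [K (x - y)] and the completed Lebesgue measure, so that
change of variables requires the invariance of that measure, including its
sigma-algebra, under reflections; it is read off from the outer measure. *)

(** * Fixed points in weighted sup norms *)

(** Continuity belongs to the class because the profile is integrated: against the
kernel, where it must be measurable, and then to solve the linear equation. *)
Definition weighted_class {R : realType} (E v : R -> R) :=
  continuous v /\ exists M, forall x, `|v x| <= M * E x.

Lemma exists_small_geometric (R : realType) (M e : R) : 0 < e ->
  exists n, M * 2^-1 ^+ n < e.
Proof.
move=> e0.
have : M * 2^-1 ^+ n @[n --> \oo] --> M * (0 : R).
  by apply: cvgM; [exact: cvg_cst | apply: cvg_expr; rewrite ger0_norm; lra].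
rewrite mulr0 => /cvgrPdist_lt/(_ e e0)[n _ /(_ n (leqnn n))] /=.
rewrite sub0r normrN => H; exists n; apply: le_lt_trans H.
exact: ler_norm.
Qed.

Lemma le0_of_geometric_bound (R : realType) (M y z : R) : 0 <= z ->
  (forall n, y <= M * 2^-1 ^+ n * z) -> y <= 0.
Proof.
move=> z0 h; apply/ler_addgt0Pl => e e0; rewrite addr0.
have [n Mn] := exists_small_geometric R M (e / (z + 1))
  (divr_gt0 e0 (ltr_wpDl z0 ltr01)).
apply: (le_trans (h n)).
apply: (@le_trans _ _ (e / (z + 1) * z)); first by rewrite ler_wpM2r // ltW.
rewrite mulrAC ler_pdivrMr; last by lra.
by rewrite ler_wpM2l ?ltW //; lra.
Qed.

Section fixed_point.
Variables (R : realType) (E : R -> R) (T : (R -> R) -> R -> R).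
Hypotheses (cE : continuous E) (E0 : forall x, 0 < E x).
Hypothesis T_class : forall v, weighted_class E v -> weighted_class E (T v).
Hypothesis T_contract : forall v w M,
  weighted_class E v -> weighted_class E w ->
  (forall x, `|v x - w x| <= M * E x) ->
  forall x, `|T v x - T w x| <= M / 2 * E x.

Let V n := iter n T (fun=> 0).

Let V_class n : weighted_class E (V n).
Proof.
elim: n => [|n IHn]; last exact: T_class.
split; first by move=> x; exact: cvg_cst.
by exists 0 => x; rewrite normr0 mul0r.
Qed.

Let V_bound : exists2 M, 0 <= M & forall n m x,
  V m x - M * 2^-1 ^+ m * E x <= V n x + M * 2^-1 ^+ n * E x.
Proof.
have [_ [M HM]] := V_class 1.
have M0 : 0 <= M.
  by have := le_trans (normr_ge0 _) (HM 0); rewrite pmulr_lge0.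
have step n x : `|V n.+1 x - V n x| <= M * 2^-1 ^+ n * E x.
  elim: n x => [|n IHn] x; first by rewrite expr0 mulr1 subr0.
  rewrite exprSr mulrA.
  exact: (T_contract _ _ _ (V_class _) (V_class _) IHn).
(* telescoping the bounds of [step], whose sum is geometric *)
have tele n k x : `|V (n + k)%N x - V n x| <=
    2 * M * (2^-1 ^+ n - 2^-1 ^+ (n + k)) * E x.
  elim: k => [|k IHk]; first by rewrite addn0 !subrr mulr0 mul0r normr0.
  rewrite addnS -[_ - _](subrKA (V (n + k)%N x)) addrC.
  apply: (le_trans (ler_normD _ _)).
  apply: (le_trans (lerD IHk (step _ _))).
  by rewrite exprS; lra.
exists (2 * M) => [|n m x]; first by rewrite mulr_ge0.
have p0 k : 0 <= 2 * M * 2^-1 ^+ k * E x.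
  by rewrite !mulr_ge0 ?exprn_ge0 ?invr_ge0 // ltW.
have [/subnKC <-|/ltnW/subnKC <-] := leqP n m.
  have := tele n (m - n)%N x; rewrite ler_norml => /andP[_].
  by have := p0 (n + (m - n))%N; lra.
have := tele m (n - m)%N x; rewrite ler_norml => /andP[+ _].
by have := p0 (m + (n - m))%N; lra.
Qed.

(** Banach's theorem for the norm [sup |v| / E].  The iterates satisfy
[|V n - V m| <= M (2^-n + 2^-m) E], so the limit can be produced pointwise as a
supremum of lower bounds, with the error estimate built in. *)
Lemma weighted_fixed_point : exists2 v, weighted_class E v & T v =1 v.
Proof.
have [M M0 HV] := V_bound.
pose v x := sup [set V m x - M * 2^-1 ^+ m * E x | m in [set: nat]].
have Vv n x : `|v x - V n x| <= M * 2^-1 ^+ n * E x.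
  rewrite ler_norml; apply/andP; split.
    have : V n x - M * 2^-1 ^+ n * E x <= v x.
      apply: ub_le_sup; last by exists n.
      by exists (V 0 x + M * 2^-1 ^+ 0 * E x) => _ [m _ <-].
    lra.
  have : v x <= V n x + M * 2^-1 ^+ n * E x.
    apply: ge_sup; last by move=> _ [m _ <-].
    by exists (V 0 x - M * 2^-1 ^+ 0 * E x); exists 0.
  lra.
have class_v : weighted_class E v.
  split; last first.
    by exists M => x; have := Vv 0 x; rewrite expr0 mulr1 subr0.
  move=> x; apply/cvgrPdist_lt => e e0.
  have EE0 : 0 < E x + 1 by have := E0 x; lra.
  have e3 : 0 < e / 3 by rewrite divr_gt0.
  have [n Mn] := exists_small_geometric R M (e / 3 / (E x + 1))
    (divr_gt0 e3 EE0).
  have := (V_class n).1 x => /cvgrPdist_lt /(_ (e / 3) e3) Vn.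
  have := cE x => /cvgrPdist_lt /(_ 1 ltr01) Ex.
  near=> y.
  have h1 : `|V n x - V n y| < e / 3 by near: y.
  have h2 : E y < E x + 1.
    have : `|E x - E y| < 1 by near: y.
    by rewrite ltr_norml => /andP[]; lra.
  have small z : E z < E x + 1 -> `|v z - V n z| < e / 3.
    move=> zx; apply: (le_lt_trans (Vv n z)).
    rewrite -[ltRHS](divfK (lt0r_neq0 EE0)).
    apply: (@le_lt_trans _ _ (M * 2^-1 ^+ n * (E x + 1))).
      by rewrite ler_wpM2l ?mulr_ge0 ?exprn_ge0 ?invr_ge0 // ltW.
    by rewrite ltr_pM2r.
  have h3 := small y h2. have h4 : `|v x - V n x| < e / 3 by apply: small; lra.
  move: h1 h3 h4; rewrite !ltr_norml => /andP[? ?] /andP[? ?] /andP[? ?].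
  by apply/andP; split; lra.
exists v => // x; apply/eqP; rewrite -subr_eq0 -normr_le0.
apply: (@le0_of_geometric_bound R M _ (E x)) => [|n]; first exact: ltW.
have h1 := T_contract _ _ _ class_v (V_class n) (Vv n) x.
have h2 := Vv n.+1 x.
rewrite -[T v x - _](subrKA (V n.+1 x)); apply: (le_trans (ler_normD _ _)).
rewrite -[X in _ + `|X|]opprB normrN.
apply: (le_trans (lerD h1 h2)); rewrite exprS; lra.
Unshelve. all: by end_near. Qed.

End fixed_point.

(** * First-order linear equations on the line *)

Definition exp_weight {R : realType} (b x : R) := expR (b * `|x|).

Lemma exp_weight_gt0 (R : realType) (b x : R) : 0 < exp_weight b x.
Proof. exact: expR_gt0. Qed.

Lemma continuous_exp_weight (R : realType) (b : R) : continuous (exp_weight b).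
Proof.
move=> x; apply: continuous_comp; last exact: continuous_expR.
by apply: cvgM; [exact: cvg_cst|exact: norm_continuous].
Qed.

(** Vanishing on the negative half-line makes [f] integrable up to any [x] from
[-oo], hence one formula gives the antiderivative on the whole line. *)
Lemma antiderivative_of_zero_on_left (R : realType) (f : R -> R) :
  continuous f -> (forall x, x <= 0 -> f x = 0) ->
  exists g : R -> R, forall x : R, is_derive x (1 : R) g (f x).
Proof.
move=> cf f0.
pose mu := @lebesgue_measure R.
exists (fun x => \int[mu]_(t in `]-oo, x]) f t) => x.
have int_f : mu.-integrable `]-oo, (x + 1)] (EFin \o f).
  have [x0|x0] := leP (x + 1) 0.
    apply: (@eq_integrable _ _ _ _ _ _ (cst 0%E)) => //.
      move=> y; rewrite inE /= in_itv /= => yx; rewrite f0 //.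
      exact: le_trans x0.
    exact: integrable0.
  have sub : `[0, x + 1] `<=` `]-oo, (x + 1)]%classic.
    by apply: subset_itvr; rewrite bnd_simp.
  have i0 : mu.-integrable `[0, x + 1] (EFin \o f).
    apply: continuous_compact_integrable; first exact: segment_compact.
    exact: continuous_subspaceT.
  move: i0 => /integrable_mkcond => /(_ (measurable_itv _)) i0.
  apply/integrable_mkcond => //; apply: eq_integrable i0 => // y _.
  rewrite !patchE /=.
  case: ifPn => [|ny]; first by rewrite inE => /sub ys; rewrite mem_set.
  case: ifPn => //; rewrite inE /= in_itv /= => yx.
  rewrite f0 //; apply: contraNT ny; rewrite -ltNge => y0.
  by rewrite inE /= in_itv /= (ltW y0).
have xx1 : x < x + 1 by rewrite ltrDl.
have [|df <-] := continuous_FTC1 xx1 int_f _ (cf x).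
  by rewrite ltNyr.
by rewrite derive1E; exact: (derivableP df).
Qed.

(** [f - f 0] splits into a part carried by the positive half-line and a part
carried by the negative one; the latter is reflected to reuse the previous
lemma. *)
Lemma antiderivative (R : realType) (f : R -> R) : continuous f ->
  exists2 g : R -> R, g 0 = 0 & forall x : R, is_derive x (1 : R) g (f x).
Proof.
move=> cf.
have cm : continuous (fun x : R => Num.max x 0).
  move=> x; apply: (@continuous_max _ _ (@id R) (cst 0)); first exact: cvg_id.
  exact: cvg_cst.
have [||g1 dg1] := @antiderivative_of_zero_on_left R
    (fun x => f (Num.max x 0) - f 0).
- move=> x; apply: cvgB; last exact: cvg_cst.
  by apply: (cvg_comp (fun x => Num.max x 0) f); [exact: cm|exact: cf].
- by move=> x x0; rewrite (max_idPr x0) subrr.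
have [||g2 dg2] := @antiderivative_of_zero_on_left R
    (fun x => f (- Num.max x 0) - f 0).
- move=> x; apply: cvgB; last exact: cvg_cst.
  apply: (cvg_comp (fun x => - Num.max x 0) f); last exact: cf.
  by apply: cvgN; exact: cm.
- by move=> x x0; rewrite (max_idPr x0) oppr0 subrr.
exists (fun x => g1 x - g2 (- x) + f 0 * x - (g1 0 - g2 0)).
  by rewrite oppr0 mulr0 addr0 subrr.
move=> x.
have dN : is_derive x (1 : R) (fun y : R => - y) (-1).
  by apply: is_deriveNid.
have dg2N := is_derive1_comp (dg2 (- x)) dN.
have := dg1 x => dg1x.
apply: is_derive_eq.
rewrite /GRing.scale /=.
have [x0|] := boolP (0 <= x).
  have -> : Num.max x 0 = x by apply/max_idPl.
  have -> : Num.max (- x) 0 = 0 by apply/max_idPr; rewrite oppr_le0.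
  rewrite oppr0; ring.
rewrite -ltNge => x0.
have -> : Num.max x 0 = 0 by apply/max_idPr/ltW.
have -> : Num.max (- x) 0 = - x by apply/max_idPl; rewrite oppr_ge0 ltW.
rewrite opprK; ring.
Qed.

Lemma is_derive_expR_scale (R : realType) (c x : R) :
  is_derive x (1 : R) (fun z => expR (c * z)) (c * expR (c * x)).
Proof.
rewrite mulrC; apply: (is_derive1_comp (is_derive_expR _)).
by apply: is_derive_eq; rewrite /GRing.scale /= mulr1.
Qed.

(** The function
[A / (b - a) * exp ((b - a) x) - exp (- a x) * u x] is nondecreasing: its
derivative is [exp (- a x) * (A * exp (b x) - h x)]. *)
Lemma growth_half_line_upper (R : realType) (a b A : R) (u h : R -> R) :
  a < b -> 0 <= A ->
  (forall x : R, is_derive x (1 : R) u (a * u x + h x)) ->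
  (forall x, 0 <= x -> h x <= A * expR (b * x)) ->
  forall x, 0 <= x -> u x <= (`|u 0| + A / (b - a)) * expR (b * x).
Proof.
move=> ab A0 du hA x x0.
pose p y := A / (b - a) * expR ((b - a) * y) - expR (- a * y) * u y.
have dp (y : R) : is_derive y (1 : R) p
    (expR (- a * y) * (A * expR (b * y) - h y)).
  have d1 := is_derive_expR_scale R (b - a) y.
  have d2 := is_derive_expR_scale R (- a) y.
  have d3 := du y.
  apply: is_derive_eq.
  have -> : b * y = a * y + (b - a) * y by ring.
  rewrite /GRing.scale /= expRD.
  rewrite -[expR (a * y)]invrK -expRN mulNr.
  by field; rewrite gt_eqF ?expR_gt0 // subr_eq0 gt_eqF.
have dpp y : derivable p y 1 by have [] := dp y.
have : p 0 <= p x.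
  apply: (@ger0_derive1_le_cc _ p 0 x) => //.
  - move=> y; rewrite in_itv /= => /andP[y0 _].
    rewrite derive1E; have -> := @derive_val _ _ _ _ _ _ _ (dp y).
    by rewrite mulr_ge0 ?expR_ge0 // subr_ge0 hA // ltW.
  - apply: continuous_subspaceT => y.
    by apply: differentiable_continuous; apply/derivable1_diffP.
  - by rewrite in_itv /= lexx.
  - by rewrite in_itv /= x0 lexx.
rewrite /p !mulr0 expR0 mulr1 mul1r => pp.
have Ab : 0 <= A / (b - a) by rewrite divr_ge0 // subr_ge0 ltW.
have u0 : expR (- a * x) * u x <= `|u 0| + A / (b - a) * expR ((b - a) * x).
  by have := ler_norm (u 0); lra.
have -> : u x = expR (a * x) * (expR (- a * x) * u x).
  by rewrite mulrA -expRD -mulrDl subrr mul0r expR0 mul1r.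
apply: (le_trans (ler_wpM2l (expR_ge0 _) u0)).
have EE : expR (a * x) * expR ((b - a) * x) = expR (b * x).
  by rewrite -expRD -mulrDl addrC subrK.
rewrite [leLHS]mulrDr [leRHS]mulrDl mulrCA EE lerD2r.
by rewrite mulrC ler_wpM2l // ler_expR ler_wpM2r // ltW.
Qed.

Lemma growth_half_line (R : realType) (a b A : R) (u h : R -> R) :
  a < b ->
  (forall x : R, is_derive x (1 : R) u (a * u x + h x)) ->
  (forall x, 0 <= x -> `|h x| <= A * expR (b * x)) ->
  forall x, 0 <= x -> `|u x| <= (`|u 0| + A / (b - a)) * expR (b * x).
Proof.
move=> ab du hA x x0.
have A0 : 0 <= A.
  by have := le_trans (normr_ge0 _) (hA 0 (lexx 0)); rewrite mulr0 expR0 mulr1.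
rewrite ler_norml; apply/andP; split; last first.
  apply: (@growth_half_line_upper _ a _ _ _ h) => // y y0.
  by apply: le_trans (hA y y0); rewrite ler_norm.
rewrite lerNl -[`|u 0|]normrN.
apply: (@growth_half_line_upper _ a b A (fun y => - u y)
  (fun y => - h y)) => //.
  move=> y; have := du y => duy; apply: is_derive_eq; ring.
move=> y y0; apply: le_trans (hA y y0).
by rewrite -normrN ler_norm.
Qed.

(** On the negative half-line [y |-> u (- y)] solves the equation with rate [- a],
for which the constant [A / (b + a)] is even smaller.  The case [a = 0] bounds
antiderivatives. *)
Lemma growth_line (R : realType) (a b A : R) (u h : R -> R) :
  0 <= a -> a < b ->
  (forall x : R, is_derive x (1 : R) u (a * u x + h x)) ->
  (forall x, `|h x| <= A * exp_weight b x) ->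
  forall x, `|u x| <= (`|u 0| + A / (b - a)) * exp_weight b x.
Proof.
rewrite /exp_weight => a0 ab du hA x.
have A0 : 0 <= A.
  by have := le_trans (normr_ge0 _) (hA 0); rewrite normr0 mulr0 expR0 mulr1.
have [x0|x0] := leP 0 x.
  rewrite (ger0_norm x0); apply: (@growth_half_line _ a b A u h) => // y y0.
  by have := hA y; rewrite (ger0_norm y0).
rewrite (ltr0_norm x0); have Nab : - a < b by lra.
have := @growth_half_line R (- a) b A (fun y => u (- y)) (fun y => - h (- y))
  Nab _ _ (- x).
rewrite oppr0 opprK => /(_ _ _ _)/le_trans; apply.
- move=> y.
  have dN : is_derive y (1 : R) (fun y : R => - y) (-1).
    exact: is_deriveNid.
  have := is_derive1_comp (du (- y)) dN => d.
  apply: is_derive_eq; ring.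
- by move=> y y0; have := hA (- y); rewrite !normrN (ger0_norm y0).
- by rewrite oppr_ge0 ltW.
- rewrite ler_wpM2r ?expR_ge0 // lerD2l ler_wpM2l //.
  by rewrite lef_pV2 ?posrE; lra.
Qed.

(** Variation of constants. *)
Lemma linear_ode (R : realType) (a u0 : R) (h : R -> R) : continuous h ->
  exists2 u : R -> R, u 0 = u0 &
    forall x : R, is_derive x (1 : R) u (a * u x + h x).
Proof.
move=> ch.
have [|g g0 dg] := @antiderivative R (fun x => expR (- a * x) * h x).
  move=> x; apply: cvgM; last exact: ch.
  apply: continuous_comp; last exact: continuous_expR.
  by apply: cvgM; [exact: cvg_cst|exact: cvg_id].
exists (fun x => expR (a * x) * (u0 + g x)).
  by rewrite mulr0 expR0 mul1r g0 addr0.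
move=> x.
have dE := is_derive_expR_scale R a x.
have := dg x => dgx.
apply: is_derive_eq.
rewrite /GRing.scale /=.
have EE : expR (a * x) * expR (- a * x) = 1.
  by rewrite -expRD -mulrDl subrr mul0r expR0.
by rewrite add0r mul1r (mulrA (expR (a * x))) EE; ring.
Qed.

(** * Reflection invariance of the completed Lebesgue measure *)

Local Notation lebesgue_type R := (caratheodory_type ((@wlength R idfun)^*)%mu).

Lemma completed_lebesgue_measure_itv (R : realType) (i : interval R) :
  @completed_lebesgue_measure R [set` i] = @lebesgue_measure R [set` i].
Proof. by []. Qed.

Lemma borel_lebesgue_measurable (R : realType) (A : set R) :
  measurable A -> @measurable _ (lebesgue_type R) A.
Proof. exact: sub_caratheodory. Qed.

Lemma continuous_lebesgue_measurable (R : realType) (f : R -> R) :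
  continuous f -> lebesgue_measurable f.
Proof.
move=> cf _ Y mY; apply: borel_lebesgue_measurable.
exact: continuous_measurable_fun.
Qed.

(** Reflecting a cover by half-open intervals gives a cover by intervals that are
open on the other side, with the same lengths; sigma-subadditivity concludes. *)
Lemma outer_lebesgue_reflection_le (R : realType) (a : R) (A : set R) :
  ((wlength idfun)^*%mu ((fun y : R => a - y)%R @^-1` A) <=
    (wlength idfun)^*%mu A)%E.
Proof.
apply: le_ereal_inf_tmp => _ [F [mF AF] <-].
apply: (@le_trans _ _ ((wlength idfun)^*%mu
    (\bigcup_k ((fun y : R => a - y)%R @^-1` (F k))))).
  apply: le_mu_ext => y Ay.
  by have [k _ Fk] := AF _ Ay; exists k.
apply: (le_trans (outer_measure_sigma_subadditive _ _)).
apply: lee_nneseries => // k _.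
move: (F k) (mF k) => B [[x y] _ <-] /=.
have -> : (fun y : R => a - y)%R @^-1` `]x, y]%classic =
    `[a - y, a - x[%classic.
  apply/seteqP; split=> z /=; rewrite !in_itv /= => /andP[h1 h2];
    apply/andP; split; lra.
rewrite -[leLHS]/(lebesgue_measure _) lebesgue_measure_itv wlength_itv /=.
rewrite !lte_fin.
have -> : (a - y < a - x) = (x < y) by apply/idP/idP; lra.
by case: ifP => // _; rewrite -!EFinB lee_fin; lra.
Qed.

Lemma outer_lebesgue_reflection (R : realType) (a : R) (A : set R) :
  ((wlength idfun)^*%mu ((fun y : R => a - y)%R @^-1` A) =
    (wlength idfun)^*%mu A)%E.
Proof.
apply/eqP; rewrite eq_le outer_lebesgue_reflection_le /=.
have {1}-> : A = (fun y : R => a - y) @^-1` ((fun y : R => a - y) @^-1` A).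
  by apply/seteqP; split=> y /=; rewrite subKr.
exact: outer_lebesgue_reflection_le.
Qed.

(** Caratheodory's criterion only mentions the outer measure, so it is preserved
by every bijection that preserves the outer measure. *)
Lemma caratheodory_reflection (R : realType) (a : R) (A : set R) :
  caratheodory_measurable ((@wlength R idfun)^*)%mu A ->
  caratheodory_measurable ((@wlength R idfun)^*)%mu
    ((fun y : R => a - y) @^-1` A).
Proof.
move=> mA X; rewrite -(outer_lebesgue_reflection R a X).
rewrite [LHS]mA.
congr (_ + _)%E; rewrite -[LHS](outer_lebesgue_reflection R a);
  congr (mu_ext _ _); apply/seteqP; split=> y /=; rewrite subKr; tauto.
Qed.

Lemma lebesgue_measurable_reflection (R : realType) (a : R) :
  @measurable_fun _ _ (lebesgue_type R) (lebesgue_type R) setT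
    (fun y : R => a - y).
Proof. by move=> _ A mA; rewrite setTI; exact: caratheodory_reflection. Qed.

Lemma completed_lebesgue_measure_reflection (R : realType) (a : R) (A : set R) :
  @completed_lebesgue_measure R ((fun y : R => a - y) @^-1` A) =
  @completed_lebesgue_measure R A.
Proof. exact: (outer_lebesgue_reflection R a A). Qed.

Section invariant_measure.
Context d (T : measurableType d) (R : realType).
Variables (mu : {measure set T -> \bar R}) (phi : T -> T).
Hypothesis mphi : measurable_fun setT phi.
Hypothesis mu_phi : forall A, measurable A -> mu (phi @^-1` A) = mu A.
Local Open Scope ereal_scope.

Lemma ge0_integral_invariant (f : T -> \bar R) :
  measurable_fun setT f -> (forall y, 0 <= f y) ->
  \int[mu]_y f (phi y) = \int[mu]_y f y.
Proof.
move=> mf f0.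
have := ge0_integral_pushforward mphi mu measurableT mf.
rewrite preimage_setT => <-; last by move=> y _.
by apply: eq_measure_integral => // A mA _; exact: mu_phi.
Qed.

Lemma integrable_invariant (f : T -> \bar R) :
  mu.-integrable setT f -> mu.-integrable setT (f \o phi).
Proof.
move=> /integrableP[mf foo]; apply/integrableP; split.
  exact: measurableT_comp.
rewrite (ge0_integral_invariant (fun x => `|f x|)) //.
exact: measurableT_comp.
Qed.

End invariant_measure.

(** * Convolution with a compactly supported kernel *)

Definition positive_part {R : realType} (v : R -> R) y := Num.max (v y) 0.

Lemma positive_part_lipschitz (R : realType) (v w : R -> R) y :
  `|positive_part v y - positive_part w y| <= `|v y - w y|.
Proof.
have half (p q : R) : Num.max p 0 - Num.max q 0 <= `|p - q|.
  have := ler_norm (p - q); have := normr_ge0 (p - q).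
  by have [?|?] := leP p 0; have [?|?] := leP q 0; lra.
by rewrite ler_norml half andbT lerNl opprB distrC half.
Qed.

Lemma le_norm_positive_part (R : realType) (v : R -> R) y :
  `|positive_part v y| <= `|v y|.
Proof.
have := positive_part_lipschitz R v (fun=> 0) y.
by rewrite /positive_part maxxx !subr0.
Qed.

Lemma continuous_positive_part (R : realType) (v : R -> R) :
  continuous v -> continuous (positive_part v).
Proof.
move=> cv x; apply: (@continuous_max _ _ v (cst 0)); first exact: cv.
exact: cvg_cst.
Qed.

(** Over an abstract measure space, with [k] as the density of the kernel and
[delay] as the amount by which the argument is shifted, the estimates do not
involve the Lebesgue measure or its completion. *)
Section delay.
Context d (T : measurableType d) (R : realType).
Variables (mu : {measure set T -> \bar R}) (delay k : T -> R) (b rho m : R).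
Hypotheses (mdelay : measurable_fun setT delay).
Hypotheses (ik : mu.-integrable setT (EFin \o k)) (k0 : forall r, 0 <= k r).
Hypotheses (km : \int[mu]_r k r <= m).
Hypothesis delay_rho : forall r, k r != 0 -> `|delay r| <= rho.
Hypothesis b0 : 0 <= b.

Local Notation E := (exp_weight b).

Lemma weight_delay x r : k r != 0 -> E (x - delay r) <= expR (b * rho) * E x.
Proof.
move=> /delay_rho dr; rewrite /exp_weight -expRD ler_expR -mulrDr.
by rewrite ler_wpM2l// (le_trans (ler_normB _ _))// addrC lerD2r.
Qed.

Lemma mul_weight_delay M (v : R -> R) x r :
  (forall y, `|v y| <= M * E y) ->
  `|v (x - delay r) * k r| <= M * expR (b * rho) * E x * k r.
Proof.
move=> vM; have [->|kr] := eqVneq (k r) 0; first by rewrite !mulr0 normr0.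
have M0 : 0 <= M.
  have := le_trans (normr_ge0 _) (vM 0).
  by rewrite pmulr_lge0 // expR_gt0.
rewrite normrM (ger0_norm (k0 r)) ler_wpM2r // (le_trans (vM _)) //.
by rewrite -mulrA ler_wpM2l // weight_delay.
Qed.

Lemma measurable_delay (v : R -> R) x : continuous v ->
  measurable_fun setT (fun r => v (x - delay r) * k r).
Proof.
move=> cv; apply: measurable_funM; last first.
  exact/measurable_EFinP/(measurable_int mu).
apply: (@measurableT_comp _ _ _ _ _ _ v).
  exact: continuous_measurable_fun.
exact: measurable_funB.
Qed.

Lemma integrable_delay M (v : R -> R) x : continuous v ->
  (forall y, `|v y| <= M * E y) ->
  mu.-integrable setT (fun r => (v (x - delay r) * k r)%:E).
Proof.
move=> cv vM.
apply: (le_integrable _ _ _ (integrableZl measurableT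
  (M * expR (b * rho) * E x) ik)) => //.
  exact/measurable_EFinP/measurable_delay.
move=> r _ /=; rewrite lee_fin (le_trans (mul_weight_delay M v x r vM)) //.
by rewrite ler_norm.
Qed.

Lemma delay_bound M (v : R -> R) x : continuous v ->
  (forall y, `|v y| <= M * E y) ->
  `|\int[mu]_r (v (x - delay r) * k r)| <= M * expR (b * rho) * m * E x.
Proof.
move=> cv vM.
have iv := integrable_delay M v x cv vM.
apply: (le_trans (le_normr_Rintegral measurableT iv)).
have iMk : mu.-integrable setT
    (EFin \o (fun r => M * expR (b * rho) * E x * k r)).
  exact: (integrableZl measurableT (M * expR (b * rho) * E x) ik).
apply: (le_trans (le_Rintegral measurableT (integrable_norm iv) iMk _)).
  by move=> r _; exact: mul_weight_delay.
rewrite RintegralZl // [leRHS]mulrAC ler_wpM2l //.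
have := le_trans (normr_ge0 _) (vM 0).
rewrite pmulr_lge0 ?expR_gt0 // => M0.
by rewrite !mulr_ge0 // expR_ge0.
Qed.

(** Dominated convergence: for [y] within distance [1] of [x], the integrand is
dominated by a fixed multiple of [k]. *)
Lemma continuous_delay M (v : R -> R) : continuous v ->
  (forall y, `|v y| <= M * E y) ->
  continuous (fun x => \int[mu]_r (v (x - delay r) * k r)).
Proof.
move=> cv vM x.
have M0 : 0 <= M.
  have := le_trans (normr_ge0 _) (vM 0).
  by rewrite pmulr_lge0 // expR_gt0.
pose C := M * expR (b * rho) * expR (b * (`|x| + 1)).
apply: (@continuity_under_integral _ _ _ mu (fun x r => v (x - delay r) * k r)
  setT measurableT (x - 1) (x + 1) _ _ (fun r => C * k r)).
- by move=> y _; exact: (integrable_delay M).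
- apply: aeW => r _ y _; apply: cvgM; last exact: cvg_cst.
  apply: (@continuous_comp _ _ _ (fun y => y - delay r) v); last exact: cv.
  by apply: cvgB; [exact: cvg_id|exact: cvg_cst].
- exact: (integrableZl measurableT C ik).
- move=> y; rewrite /= in_itv /= => /andP[y1 y2]; apply: aeW => r _.
  apply: (le_trans (mul_weight_delay M v y r vM)).
  rewrite ler_wpM2r // ler_wpM2l ?mulr_ge0 ?expR_ge0 //.
  rewrite ler_expR ler_wpM2l //.
  rewrite -[y](subrK x) addrC (le_trans (ler_normD _ _)) // lerD2l.
  by rewrite ler_norml; apply/andP; split; lra.
- by rewrite inE /= in_itv /=; apply/andP; split; lra.
Qed.

Definition delayed_source (v : R -> R) x :=
  \int[mu]_r (positive_part v (x - delay r) * k r).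

Lemma integrable_delayed_source (v : R -> R) x : weighted_class E v ->
  mu.-integrable setT (fun r => (positive_part v (x - delay r) * k r)%:E).
Proof.
move=> [cv [M vM]]; apply: (integrable_delay M).
  exact: continuous_positive_part.
by move=> y; apply: le_trans (vM y); exact: le_norm_positive_part.
Qed.

Lemma delayed_source_class (v : R -> R) :
  weighted_class E v -> weighted_class E (delayed_source v).
Proof.
move=> [cv [M vM]].
have cpv := continuous_positive_part R v cv.
have pM y : `|positive_part v y| <= M * E y.
  by apply: le_trans (vM y); exact: le_norm_positive_part.
split; first exact: (continuous_delay M).
by exists (M * expR (b * rho) * m) => x; exact: delay_bound.
Qed.

Lemma delayed_source_lipschitz (v w : R -> R) M :
  weighted_class E v -> weighted_class E w ->
  (forall x, `|v x - w x| <= M * E x) ->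
  forall x, `|delayed_source v x - delayed_source w x| <=
    expR (b * rho) * m * M * E x.
Proof.
move=> Cv Cw vw x.
rewrite /delayed_source -RintegralB //; try exact: integrable_delayed_source.
under eq_Rintegral do rewrite -mulrBl.
have -> : expR (b * rho) * m * M = M * expR (b * rho) * m by ring.
apply: (delay_bound M (fun y => positive_part v y - positive_part w y)).
  by move=> y; apply: cvgB; apply: continuous_positive_part;
    [exact: Cv.1|exact: Cw.1].
by move=> y; apply: le_trans (vw y); exact: positive_part_lipschitz.
Qed.

End delay.

Lemma lebesgue_kernel (R : realType) (rho Lambda : R) (K : R -> R) :
  0 < rho -> lebesgue_measurable K -> (forall r, 0 <= K r) ->
  (forall r, K r <= Lambda * \1_(`](- rho), rho[%classic) r) ->
  let mu := @completed_lebesgue_measure R in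
  [/\ mu.-integrable setT (EFin \o K),
    Rintegral mu setT K <= 2 * rho * Lambda &
    forall r, K r != 0 -> `|r| <= rho].
Proof.
move=> rho0 mK K0 KL mu.
have mI : @measurable _ (lebesgue_type R) `](- rho), rho[%classic.
  by apply: borel_lebesgue_measurable; exact: measurable_itv.
have muI : mu `](- rho), rho[%classic = (2 * rho)%:E.
  rewrite /mu completed_lebesgue_measure_itv lebesgue_measure_itv /= lte_fin.
  rewrite ifT; last by lra.
  by rewrite -EFinB; congr EFin; ring.
have mind : measurable_fun setT
    (\1_(`](- rho), rho[%classic) : lebesgue_type R -> R).
  exact: measurable_indic.
have iI : mu.-integrable setT (fun r => (\1_(`](- rho), rho[%classic) r)%:E).
  apply/integrableP; split; first exact/measurable_EFinP.
  under eq_integral do rewrite /= ger0_norm //.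
  by rewrite integral_indic // setIT [ltLHS]muI ltry.
have iLI : mu.-integrable setT
    (EFin \o (fun r => Lambda * \1_(`](- rho), rho[%classic) r)).
  exact: (integrableZl measurableT Lambda iI).
have iK : mu.-integrable setT (EFin \o K).
  apply: (le_integrable measurableT _ _ iLI); first exact/measurable_EFinP.
  move=> r _ /=; rewrite lee_fin ger0_norm //.
  by apply: (le_trans (KL r)); exact: ler_norm.
split=> //.
  apply: (le_trans (le_Rintegral measurableT iK iLI (fun r _ => KL r))).
  rewrite RintegralZl // /Rintegral integral_indic // setIT [X in fine X]muI /=.
  by rewrite mulrC.
move=> r Kr; rewrite ler_norml; move: (KL r); rewrite indicE.
case: (boolP (r \in _)) => [|_]; last first.
  by rewrite mulr0 => Kr0; case/eqP: Kr; apply/eqP; rewrite eq_le Kr0 K0.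
by rewrite inE /= in_itv /= => /andP[/ltW-> /ltW->].
Qed.

(** The substitution [y = x - r], which moves the dependence on [x] from the
merely measurable kernel to the continuous profile. *)
Lemma convolution_reflection (R : realType) (K p : R -> R) (x z : R) :
  let mu := @completed_lebesgue_measure R in
  let g r := p (z - r) * K r in
  (forall r, 0 <= g r) -> mu.-integrable setT (EFin \o g) ->
  mu.-integrable setT (fun y => (p (z - x + y) * K (x - y))%:E) /\
  Rintegral mu setT (fun y => p (z - x + y) * K (x - y)) = Rintegral mu setT g.
Proof.
move=> mu g g0 ig.
have gE : (fun y => (p (z - x + y) * K (x - y))%:E) =
    (EFin \o g) \o (fun y => x - y).
  by apply/funext => y; rewrite /g /= opprB addrCA addrC -addrA addrC.
have refl := lebesgue_measurable_reflection R x.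
have inv A (_ : @measurable _ (lebesgue_type R) A) :=
  completed_lebesgue_measure_reflection R x A.
split.
  by rewrite gE; exact: (integrable_invariant _ _ _ mu _ refl inv _ ig).
have mg : @measurable_fun _ _ (lebesgue_type R) _ setT (EFin \o g).
  exact: measurable_int ig.
have g0' y : (0 <= (EFin \o g) y)%E by rewrite lee_fin.
rewrite /Rintegral gE; congr (fine _).
exact: (ge0_integral_invariant _ _ _ mu _ refl inv _ mg g0').
Qed.

(** * Travelling waves *)

Lemma is_derive_continuous (R : realType) (f df : R -> R) :
  (forall x : R, is_derive x (1 : R) f (df x)) -> continuous f.
Proof.
move=> d x; apply: differentiable_continuous; apply/derivable1_diffP.
by have [] := d x.
Qed.

(** Contraction for the map sending [v] to the solution [V] of
[V'' = a V' - F v / c] with [V 0 = 0] and [V' 0 = kappa]; the Lipschitz constant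
of this map is [L / (2 c a^2)]. *)
Lemma profile_exists (R : realType) (a c kappa L : R)
    (F : (R -> R) -> R -> R) :
  let E : R -> R := exp_weight (2 * a) in
  0 < a -> 0 < c -> L <= c * a ^+ 2 ->
  (forall v, weighted_class E v -> weighted_class E (F v)) ->
  (forall v w M, weighted_class E v -> weighted_class E w ->
    (forall x, `|v x - w x| <= M * E x) ->
    forall x, `|F v x - F w x| <= L * M * E x) ->
  exists v w : R -> R, [/\ weighted_class E v, v 0 = 0, w 0 = kappa,
    (forall x : R, is_derive x (1 : R) v (w x)) &
    (forall x : R, is_derive x (1 : R) w (a * w x - F v x / c))].
Proof.
move=> E a0 c0 Lsmall F_class F_lip.
pose sol v (p : (R -> R) * (R -> R)) := weighted_class E v ->
  [/\ p.1 0 = 0, p.2 0 = kappa,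
    (forall x : R, is_derive x (1 : R) p.1 (p.2 x)) &
    (forall x : R, is_derive x (1 : R) p.2 (a * p.2 x - F v x / c))].
(* outside the weighted class the choice of [p] is arbitrary *)
have sol_ex v : exists p, sol v p.
  have [Cv|nCv] := pselect (weighted_class E v); last first.
    by exists ((fun=> 0), (fun=> 0)) => /nCv.
  have cF : continuous (fun x => - (F v x / c)).
    move=> x; apply: cvgN; apply: cvgM; last exact: cvg_cst.
    exact: (F_class v Cv).1.
  have [w w0 dw] := linear_ode R a kappa _ cF.
  have [v1 v10 dv1] := antiderivative R w (is_derive_continuous R _ _ dw).
  by exists (v1, w).
have [P HP] := choice sol_ex.
have ab : a < 2 * a by lra.
have b0 : 0 < 2 * a by lra.
have sub_deriv (f g df dg : R -> R) :
    (forall x : R, is_derive x (1 : R) f (df x)) ->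
    (forall x : R, is_derive x (1 : R) g (dg x)) ->
    forall x : R, is_derive x (1 : R) (fun y => f y - g y) (df x - dg x).
  by move=> hf hg x; have := hf x => ?; have := hg x => ?; apply: is_derive_eq.
have T_class v : weighted_class E v -> weighted_class E (P v).1.
  move=> Cv; have [p0 w0 dp dw] := HP v Cv.
  split; first exact: is_derive_continuous dp.
  have [_ [B HB]] := F_class v Cv.
  have hw := @growth_line R a (2 * a) (B / c) (P v).2 _ (ltW a0) ab dw.
  have {}hw x : `|(P v).2 x| <= (`|(P v).2 0| + B / c / (2 * a - a)) * E x.
    apply: hw => y; rewrite normrN normrM normfV (gtr0_norm c0) mulrAC.
    by apply: ler_wpM2r; [rewrite invr_ge0 ltW|exact: HB].
  have dp' x : is_derive x (1 : R) (P v).1 (0 * (P v).1 x + (P v).2 x).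
    by rewrite mul0r add0r.
  have hp := @growth_line R 0 (2 * a) _ (P v).1 _ (lexx 0) b0 dp' hw.
  by eexists; exact: hp.
have T_contract v w M : weighted_class E v -> weighted_class E w ->
    (forall x, `|v x - w x| <= M * E x) ->
    forall x, `|(P v).1 x - (P w).1 x| <= M / 2 * E x.
  move=> Cv Cw vw.
  have M0 : 0 <= M.
    by have := le_trans (normr_ge0 _) (vw 0); rewrite pmulr_lge0 ?expR_gt0.
  have [p0 w0 dp dw] := HP v Cv; have [q0 z0 dq dz] := HP w Cw.
  have dwz (x : R) : is_derive x (1 : R) (fun y => (P v).2 y - (P w).2 y)
      (a * ((P v).2 x - (P w).2 x) + - ((F v x - F w x) / c)).
    have := sub_deriv _ _ _ _ dw dz x => d.
    by apply: (is_derive_eq d); ring.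
  have hw := @growth_line R a (2 * a) (L * M / c) _ _ (ltW a0) ab dwz.
  have {}hw x : `|(P v).2 x - (P w).2 x| <= L * M / c / a * E x.
    have -> : L * M / c / a =
        `|(P v).2 0 - (P w).2 0| + L * M / c / (2 * a - a).
      by rewrite w0 z0 subrr normr0 add0r; congr (_ / _); ring.
    apply: hw => y; rewrite normrN normrM normfV (gtr0_norm c0) mulrAC.
    by apply: ler_wpM2r; [rewrite invr_ge0 ltW|exact: F_lip].
  have dpq (x : R) : is_derive x (1 : R) (fun y => (P v).1 y - (P w).1 y)
      (0 * ((P v).1 x - (P w).1 x) + ((P v).2 x - (P w).2 x)).
    by rewrite mul0r add0r; exact: sub_deriv.
  move=> x.
  have := @growth_line R 0 (2 * a) _ _ _ (lexx 0) b0 dpq hw x.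
  rewrite p0 q0 !subr0 normr0 add0r => /le_trans; apply.
  rewrite ler_wpM2r ?expR_ge0 //.
  have -> : L * M / c / a / (2 * a) = (L / (c * a ^+ 2)) * (M / 2).
    by field; rewrite !gt_eqF.
  rewrite -[leRHS]mul1r ler_wpM2r ?divr_ge0 //.
  by rewrite ler_pdivrMr ?mul1r // mulr_gt0 // exprn_gt0.
have [v Cv fv] := weighted_fixed_point R E (fun v => (P v).1)
  (continuous_exp_weight R _) (exp_weight_gt0 R _) T_class T_contract.
have [p0 w0 dp dw] := HP v Cv.
have {}fv : (P v).1 = v by apply/funext.
by exists v, (P v).2; rewrite fv in p0 dp *.
Qed.

Lemma is_derive_affine (R : realType) (f df : R -> R) (p q C s : R) :
  (forall x : R, is_derive x (1 : R) f (df x)) ->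
  is_derive s (1 : R) (fun s => f (p + q * s) + C) (q * df (p + q * s)).
Proof.
move=> hf.
have d1 : is_derive s (1 : R) (fun s => p + q * s) q.
  by apply: is_derive_eq; rewrite /GRing.scale /= add0r mul1r mulr1.
have d2 := @is_derive1_comp R f (fun s => p + q * s) s _ _ (hf (p + q * s)) d1.
by apply: is_derive_eq; rewrite addr0 mulrC.
Qed.

(** Along [x + omega t] the time derivative is [omega] times the space derivative,
and joint continuity is inherited from one variable. *)
Lemma wave_regularity (R : realType) (v w z : R -> R) (omega Theta : R) :
  (forall x : R, is_derive x (1 : R) v (w x)) ->
  (forall x : R, is_derive x (1 : R) w (z x)) -> continuous z ->
  let u x t := v (x + omega * t) + Theta in
  [/\ classical_regularity u,
    (forall x t, dt u x t = omega * w (x + omega * t)) &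
    (forall x t, dx (dx u) x t = z (x + omega * t))].
Proof.
move=> dv dw cz u.
have ut x t : is_derive t (1 : R) (fun s => u x s) (omega * w (x + omega * t)).
  exact: (is_derive_affine R v w x omega Theta t dv).
have shift (f df : R -> R) (C x t : R) :
    (forall x : R, is_derive x (1 : R) f (df x)) ->
    is_derive x (1 : R) (fun y => f (y + omega * t) + C) (df (x + omega * t)).
  move=> hf; have := is_derive_affine R f df (omega * t) 1 C x hf.
  rewrite !mul1r [omega * t + x]addrC.
  congr (is_derive _ _ _ _); apply/funext => y.
  by rewrite mul1r [omega * t + y]addrC.
have ux x t : is_derive x (1 : R) (fun y => u y t) (w (x + omega * t)).
  exact: shift.
have dtE : dt u = fun x t => omega * w (x + omega * t).
  by apply/funext => x; apply/funext => t; rewrite /dt derive1E;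
    have [_ ->] := ut x t.
have dxE : dx u = fun x t => w (x + omega * t).
  by apply/funext => x; apply/funext => t; rewrite /dx derive1E;
    have [_ ->] := ux x t.
have uxx x t : is_derive x (1 : R) (fun y => dx u y t) (z (x + omega * t)).
  rewrite dxE; have := shift w z 0 x t dw.
  congr (is_derive _ _ _ _); apply/funext => y; exact: addr0.
have dxxE : dx (dx u) = fun x t => z (x + omega * t).
  by apply/funext => x; apply/funext => t; rewrite [LHS]derive1E;
    have [_ ->] := uxx x t.
have joint (f : R -> R) : continuous f ->
    continuous (fun y : R * R => f (y.1 + omega * y.2)).
  move=> cf y; apply: (cvg_comp (fun y : R * R => y.1 + omega * y.2) f);
    last exact: cf.
  apply: cvgD; first exact: cvg_fst.
  by apply: cvgM; [exact: cvg_cst|exact: cvg_snd].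
have cv := is_derive_continuous R _ _ dv.
have cw := is_derive_continuous R _ _ dw.
split; last 2 first.
- by move=> x t; rewrite dtE.
- by move=> x t; rewrite dxxE.
split.
- by move=> x t; have [] := ut x t.
- by move=> x t; have [] := ux x t.
- by move=> x t; have [] := uxx x t.
- split.
  + by move=> y; apply: cvgD; [exact: joint|exact: cvg_cst].
  + by rewrite dtE => y; apply: cvgM; [exact: cvg_cst|exact: (joint w)].
  + by rewrite dxE; exact: joint.
  + by rewrite dxxE; exact: joint.
Qed.

Theorem theorem2p8 (R : realType) (c rho omega : R)
    (hc : 0 < c) (hrho : 0 < rho) (homega : 0 < omega) :
  exists2 Lambda_star : R, 0 < Lambda_star &
    forall kappa Theta Lambda : R, 0 < kappa ->
      0 < Lambda -> Lambda < Lambda_star ->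
    forall K : R -> R,
      lebesgue_measurable K ->
      (forall r, 0 <= K r) ->
      (forall r, K r <= Lambda * \1_(`](- rho), rho[%classic) r) ->
    exists (u : R -> R -> R) (v : R -> R),
      [/\ classical_solution c Theta K u,
          (forall x t, u x t = v (x + omega * t) + Theta),
          v 0 = 0 &
          is_derive (0 : R) (1 : R) v kappa].
Proof.
pose a := omega / c.
have a0 : 0 < a by rewrite divr_gt0.
have b0 : 0 <= 2 * a by lra.
pose B := expR (2 * a * rho) * (2 * rho).
have B0 : 0 < B by rewrite mulr_gt0 ?expR_gt0 ?mulr_gt0.
exists (c * a ^+ 2 / B); first by rewrite divr_gt0 // mulr_gt0 // exprn_gt0.
move=> kappa Theta Lambda _ Lambda0 LambdaB K mK K0 KL.
pose mu := @completed_lebesgue_measure R.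
have [iK Km Krho] := lebesgue_kernel R rho Lambda K hrho mK K0 KL.
have mid : measurable_fun setT (idfun : lebesgue_type R -> R).
  by apply: (continuous_lebesgue_measurable R idfun) => x; exact: cvg_id.
pose F := delayed_source _ (lebesgue_type R) R mu idfun K.
have F_class := delayed_source_class _ _ _ mu _ _ _ _ _ mid iK K0 Km Krho b0.
have F_lip := delayed_source_lipschitz _ _ _ mu _ _ _ _ _ mid iK K0 Km Krho b0.
have small : expR (2 * a * rho) * (2 * rho * Lambda) <= c * a ^+ 2.
  by rewrite mulrA -/B mulrC -ler_pdivlMr // ltW.
have [v [w [Cv v0 w0 dv dw]]] :=
  profile_exists R a c kappa _ F a0 hc small F_class F_lip.
have cz : continuous (fun x => a * w x - F v x / c).
  move=> x; apply: cvgB; apply: cvgM.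
  - exact: cvg_cst.
  - exact: is_derive_continuous dw _.
  - exact: (F_class v Cv).1.
  - exact: cvg_cst.
pose u x t := v (x + omega * t) + Theta.
have [reg ut uxx] := wave_regularity R v w _ omega Theta dv dw cz.
exists u, v; split=> //; last by rewrite -w0.
split=> // x t.
have g0 r : 0 <= positive_part v (x + omega * t - r) * K r.
  by rewrite mulr_ge0 // le_max lexx orbT.
have ig := integrable_delayed_source _ _ _ mu _ _ _ _ mid iK K0 Krho b0 v
  (x + omega * t) Cv.
have [iy ey] := convolution_reflection R K (positive_part v) x
  (x + omega * t) g0 ig.
have gE : (fun y => Num.max (u y t - Theta) 0 * K (x - y)) =
    (fun y => positive_part v (x + omega * t - x + y) * K (x - y)).
  apply/funext => y; rewrite /positive_part /u addrK.
  by have -> : x + omega * t - x + y = y + omega * t by ring.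
split.
  suff -> : (fun y => (Num.max (u y t - Theta) 0 * K (x - y))%:E) =
      (fun y => (positive_part v (x + omega * t - x + y) * K (x - y))%:E) by [].
  by apply/funext => y; have /(congr1 (fun f => f y)) /= -> := gE.
have {}ey : _ = F v (x + omega * t) := ey.
rewrite gE ey ut uxx /a.
by field; rewrite gt_eqF.
Qed.
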